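(* Let $f,g\in\mathbb{C}[x]$ be nonzero polynomials with $\deg f<\deg g<2\deg f+1$. Then the Liénard dynamical system $x_t=y$, $y_t=-f(x)y-g(x)$ is not integrable with a rational first integral, i.e. it has no rational first integral.
   Context: A rational first integral of the system is a rational function $R\in\mathbb{C}(x,y)\setminus\mathbb{C}$ such that $yR_x-\{f(x)y+g(x)\}R_y=0$. *)

(* Defs.v *)
From mathcomp Require Import all_boot all_order all_algebra.
From mathcomp Require Import fraction.
From mathcomp Require Import ring.
From mathcomp Require Import complex.
From mathcomp Require Import reals.

Set Implicit Arguments.
Unset Strict Implicit.
Unset Printing Implicit Defensive.

Import GRing.Theory.
Local Open Scope ring_scope.

Local Notation "x %:F" := (@FracField.tofrac _ x).

(* Quotient rule: the extension to the fraction field of a derivation d of A.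
   It is computed on the canonical representative; frac_der_div shows that the
   value does not depend on this choice. *)
Definition frac_der (A : idomainType) (d : A -> A) (r : {fraction A}) :
    {fraction A} :=
  let p := \n_(repr r) in
  let q := \d_(repr r) in
  (d p * q - p * d q)%:F / (q ^+ 2)%:F.

Lemma frac_der_div (A : idomainType) (d : A -> A)
    (dM : forall a b, d (a * b) = d a * b + a * d b) (p q : A) :
  q != 0 -> frac_der d (p%:F / q%:F) = (d p * q - p * d q)%:F / (q ^+ 2)%:F.
Proof.
move=> q0; rewrite /frac_der.
set r := p%:F / q%:F; set n := (frac (repr r)).1; set m := (frac (repr r)).2.
have m0 : m != 0 by exact: denom_ratioP.
have rE : r = n%:F / m%:F.
  apply: (@mulIf _ m%:F); first by rewrite tofrac_eq0.
  rewrite divfK ?tofrac_eq0 // -[X in X * _]reprK; unlock FracField.tofrac.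
  rewrite -[LHS]FracField.pi_mul; apply/eqmodP.
  rewrite /= FracField.equivfE /FracField.mulf.
  by rewrite !numden_Ratio ?mulf_neq0 ?oner_eq0 // !mulr1 mulrC.
have pm : p * m = n * q.
  apply/eqP; rewrite -tofrac_eq !tofracM.
  by move/eqP: rE; rewrite /r eqr_div ?tofrac_eq0.
have dpm : d p * m = d n * q + n * d q - p * d m.
  by rewrite -dM -pm dM addrK.
apply/eqP; rewrite eqr_div ?tofrac_eq0 ?expf_neq0 // -!tofracM tofrac_eq.
apply/eqP.
have -> : (d p * q - p * d q) * m ^+ 2
        = (d p * m) * (q * m) - (p * m) * (d q * m) by ring.
rewrite dpm pm.
have -> : (d n * q + n * d q - p * d m) * (q * m) - n * q * (d q * m)
        = d n * q ^+ 2 * m - (p * m) * (d m * q) by ring.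
by rewrite pm; ring.
Qed.

(* C[x,y] is C[x][y]: the outer indeterminate 'X is y, the inner one 'X%:P is x
   (polyXY uses the opposite order). *)
Notation ratfun K := {fraction {poly {poly K}}}.

Definition partial_x (K : fieldType) : ratfun K -> ratfun K :=
  @frac_der {poly {poly K}} (map_poly (@deriv K)).

Definition partial_y (K : fieldType) : ratfun K -> ratfun K :=
  @frac_der {poly {poly K}} (@deriv {poly K}).

Lemma partial_x_div (K : fieldType) (p q : {poly {poly K}}) : q != 0 ->
  partial_x (p%:F / q%:F) =
  (map_poly (@deriv K) p * q - p * map_poly (@deriv K) q)%:F / (q ^+ 2)%:F.
Proof.
apply: frac_der_div => a b; apply/polyP => i.
rewrite coefD coef_map_id0 ?deriv0 // !coefM linear_sum -big_split /=.
apply: eq_bigr => j _; rewrite !coef_map_id0 ?deriv0 //.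
exact: derivM.
Qed.

Lemma partial_y_div (K : fieldType) (p q : {poly {poly K}}) : q != 0 ->
  partial_y (p%:F / q%:F) = (p^`() * q - p * q^`())%:F / (q ^+ 2)%:F.
Proof. by apply: frac_der_div => a b; exact: derivM. Qed.

Definition rf_const (K : fieldType) (c : K) : ratfun K := c%:P%:P%:F.

Definition rf_y (K : fieldType) : ratfun K := 'X%:F.

Definition rf_of_x (K : fieldType) (p : {poly K}) : ratfun K := p%:P%:F.

Definition lienard_rational_first_integral (K : fieldType) (f g : {poly K})
    (r : ratfun K) : Prop :=
  (~ exists c : K, r = rf_const c) /\
  rf_y K * partial_x r - (rf_of_x f * rf_y K + rf_of_x g) * partial_y r = 0.

(* Main.v *)
Require Import Defs.
From mathcomp Require Import all_boot all_order all_algebra.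
From mathcomp Require Import fraction.
From mathcomp Require Import complex.
From mathcomp Require Import reals.
From mathcomp Require Import zify ring.

Set Implicit Arguments.
Unset Strict Implicit.
Unset Printing Implicit Defensive.

Import Order.TTheory GRing.Theory Num.Theory.
Local Open Scope ring_scope.

(** Let D = y d/dx - (f y + g) d/dy be the derivation of the Lienard field, and
    let m = deg f, n = deg g.  A rational first integral P/Q satisfies
    DP * Q = P * DQ.  If P and Q are coprime over C(x), with a Bezout identity
    u P + v Q = S(x), then P and Q are D-invariant with the same cofactor: there
    is L = L0(x) + L1(x) y such that S DP = L P and S DQ = L Q.

    The point is that, for m < n < 2 m + 1, the triple (S, L0, L1) determines
    both the y-degree d of a nonzero invariant polynomial P = sum_j p_j(x) y^j
    and the x-degree beta of its leading coefficient p_d.  Since every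
    P - c Q with c constant has the same cofactor, one may choose c so that the
    coefficient of x^beta y^d vanishes; then P - c Q = 0 and P/Q is constant.

    To read d off the cofactor, recall that at x = oo the invariant curves have
    only two kinds of branches: y ~ - (f0/(m+1)) x^(m+1), with f0 the leading
    coefficient of f, and y ~ - g/f, of order r = n - m.  If k is the number of
    branches of the second kind, then d - k are of the first kind.  Instead of
    Puiseux series, the proof uses the coefficients of y^j in S DP = L P,

       S p_(j-1)' - L1 p_(j-1) = (j S f + L0) p_j + (j+1) S g p_(j+1),

    together with the two gradings for which y has the weight of one of these
    branches.  In the grading with weight m+1 (outer_weights) the top part of P
    starts at y^k, where k is given by the coefficient of L0 of degree
    deg S + m, and has total weight beta + d (m+1); hence
    deg p_k = beta + (d-k)(m+1), and the leading term of p_(k+1) is known.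
    In the grading with weight r (inner_weights) the top part of P ends at y^k,
    and the leading term of p_(k-1) is known.  Inserting both neighbours into
    the equation for j = k (cofactor_leading_data) expresses the next
    coefficient of k S f + L0 through r k - (d-k)(m+1), which gives d. *)

(** * Coefficients indexed by integers *)

(** With an integer index (zero when it is negative) the weighted top
    coefficients p_j`_(w - j * al) make sense for every j. *)
Definition coefz (A : nzRingType) (p : {poly A}) (z : int) : A :=
  if z is Posz i then p`_i else 0.

(** The degree bound that goes with [coefz]; for negative z it says p = 0. *)
Definition deg_le (A : nzRingType) (p : {poly A}) (z : int) : Prop :=
  forall t : int, (z < t)%R -> coefz p t = 0.

Lemma coefz0 (A : nzRingType) (z : int) : coefz (0 : {poly A}) z = 0.
Proof. by case: z => // i; rewrite /= coef0. Qed.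

Lemma coefzD (A : nzRingType) (p q : {poly A}) z :
  coefz (p + q) z = coefz p z + coefz q z.
Proof. by case: z => i /=; rewrite ?coefD ?addr0. Qed.

Lemma coefzN (A : nzRingType) (p : {poly A}) z : coefz (- p) z = - coefz p z.
Proof. by case: z => i /=; rewrite ?coefN ?oppr0. Qed.

Lemma coefzMn (A : nzRingType) (p : {poly A}) n z :
  coefz (p *+ n) z = coefz p z *+ n.
Proof. by case: z => i /=; rewrite ?coefMn ?mul0rn. Qed.

Lemma coefz_deriv (A : nzRingType) (p : {poly A}) z :
  coefz p^`() (z - 1) = coefz p z *~ z.
Proof.
case: z => [[|i]|i]; first by rewrite mulr0z.
- have -> : (Posz i.+1 - 1 = i)%R by lia.
  by rewrite /= coef_deriv pmulrn.
- have -> : (Negz i - 1 = Negz i.+1)%R by lia.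
  by rewrite /= mul0rz.
Qed.

Lemma deg_leW (A : nzRingType) (p : {poly A}) (a b : int) :
  (a <= b)%R -> deg_le p a -> deg_le p b.
Proof. by move=> ab pa t bt; apply: pa; lia. Qed.

Lemma deg_le0 (A : nzRingType) a : deg_le (0 : {poly A}) a.
Proof. by move=> t _; rewrite coefz0. Qed.

Lemma deg_leD (A : nzRingType) (p q : {poly A}) (a : int) :
  deg_le p a -> deg_le q a -> deg_le (p + q) a.
Proof. by move=> pa qa t at_; rewrite coefzD pa // qa // addr0. Qed.

Lemma deg_leN (A : nzRingType) (p : {poly A}) (a : int) :
  deg_le p a -> deg_le (- p) a.
Proof. by move=> pa t at_; rewrite coefzN pa // oppr0. Qed.

Lemma deg_leMn (A : nzRingType) (p : {poly A}) (a : int) n :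
  deg_le p a -> deg_le (p *+ n) a.
Proof. by move=> pa t at_; rewrite coefzMn pa // mul0rn. Qed.

Lemma deg_le_deriv (A : nzRingType) (p : {poly A}) (a : int) :
  deg_le p a -> deg_le p^`() (a - 1).
Proof.
move=> pa t at_; rewrite -[t](addrK 1) coefz_deriv pa ?mul0rz //; lia.
Qed.

Lemma deg_le_size (A : nzRingType) (p : {poly A}) :
  deg_le p (size p).-1%:Z.
Proof.
case=> // i; rewrite ltz_nat => hi; apply: nth_default.
by case: (size p) hi.
Qed.

Lemma deg_le_neg (A : nzRingType) (p : {poly A}) (a : int) :
  (a < 0)%R -> deg_le p a -> p = 0.
Proof.
move=> a0 pa; apply/polyP => i; rewrite coef0.
by apply: (pa i%:Z); lia.
Qed.

Lemma coefzM (A : nzRingType) (p q : {poly A}) (a b t : int) :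
  deg_le p a -> deg_le q b -> (a + b <= t)%R ->
  coefz (p * q) t = coefz p a * coefz q (t - a).
Proof.
case: a => [a|a] pa qb abt; last by rewrite (deg_le_neg _ pa) ?mul0r ?coefz0.
case: b abt qb => [b|b] abt qb.
  case: t abt => [t|//] abt; rewrite /= coefM.
  have at_ : (a < t.+1)%N by lia.
  rewrite (bigD1 (Ordinal at_)) //= big1 => [|i /eqP ia].
    by rewrite addr0 subzn //=; lia.
  have [ai|ia'] := ltnP a i.
    by rewrite [p`_i](pa i%:Z) ?mul0r //; lia.
  have ne : (i : nat) <> a by move=> e; apply: ia; apply: val_inj.
  by rewrite [q`_(t - i)](qb (t - i)%N%:Z) ?mulr0 //; lia.
by rewrite (deg_le_neg _ qb) ?mulr0 ?coefz0 ?mulr0.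
Qed.

Lemma coefzM_top (A : nzRingType) (p q : {poly A}) (a b t : int) :
  deg_le p a -> deg_le q b -> t = a + b ->
  coefz (p * q) t = coefz p a * coefz q b.
Proof. by move=> pa qb ->; rewrite (coefzM pa qb) ?lexx // addrC addKr. Qed.

Lemma deg_leM (A : nzRingType) (p q : {poly A}) (a b c : int) :
  deg_le p a -> deg_le q b -> (a + b <= c)%R -> deg_le (p * q) c.
Proof.
by move=> pa qb abc t ct; rewrite (coefzM pa qb) ?qb ?mulr0 //; lia.
Qed.

Lemma deg_le_factor (A : idomainType) (p q : {poly A}) (b c : int) :
  deg_le q b -> coefz q b != 0 -> deg_le (p * q) c -> deg_le p (c - b).
Proof.
move=> qb qb0 pqc; have [->|p0] := eqVneq p 0; first exact: deg_le0.
have pd := @deg_le_size _ p.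
have [dc|cd] := lerP (size p).-1%:Z (c - b); first exact: deg_leW dc pd.
have /eqP := coefzM_top pd qb erefl; rewrite pqc -?ltrBlDr //.
by rewrite eq_sym mulf_eq0 (negbTE qb0) orbF /= -lead_coefE lead_coef_eq0
  (negbTE p0).
Qed.

Lemma coefz_size (A : nzRingType) (p : {poly A}) :
  coefz p (size p).-1%:Z = lead_coef p.
Proof. by []. Qed.

Lemma deg_le_unique (A : nzRingType) (p : {poly A}) (a b : int) :
  deg_le p a -> coefz p a != 0 -> deg_le p b -> coefz p b != 0 -> a = b.
Proof.
move=> pa pa0 pb pb0; case: (ltgtP a b) => // [ab|ba].
- by rewrite pa ?eqxx in pb0.
- by rewrite pb ?eqxx in pa0.
Qed.

(** * The Lienard derivation and its invariant polynomials *)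

Definition lienard_der (K : fieldType) (f g : {poly K}) (P : {poly {poly K}}) :
    {poly {poly K}} :=
  'X * map_poly (@deriv K) P - (f%:P * 'X + g%:P) * P^`().

(** Clearing the denominator S of the cofactor keeps everything polynomial: an
    invariant polynomial over C(x) has a cofactor in C(x)[y], of degree at most
    1 in y because D raises the y-degree by at most one. *)
Definition lienard_invariant (K : fieldType) (f g S L0 L1 : {poly K})
    (P : {poly {poly K}}) : Prop :=
  S%:P * lienard_der f g P = (L0%:P + L1%:P * 'X) * P.

(** Multiplication by 'X in ['X * P] is a shift that includes the convention
    p_(-1) = 0. *)
Lemma invariant_coef (K : fieldType) (f g S L0 L1 : {poly K})
    (P : {poly {poly K}}) :
  lienard_invariant f g S L0 L1 P ->
  forall j, S * (('X * P)`_j)^`() - L1 * ('X * P)`_j =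
            (S * f *+ j + L0) * P`_j + S * g * P`_j.+1 *+ j.+1.
Proof.
move=> PE j; have := congr1 (fun p : {poly {poly K}} => p`_j) PE.
rewrite coefCM /lienard_der coefB [(_ + g%:P) * _]mulrDl [(_ + _) * P]mulrDl.
rewrite -[f%:P * _ * _]mulrA -[L1%:P * _ * _]mulrA !coefD !coefCM !coefXM.
have key (A : comNzRingType) (x a b c s e l l1 q n n1 : A) :
    s * (x - (a * (b * n) + e * (c * n1))) = l * b + l1 * q ->
    s * x - l1 * q = (s * a * n + l) * b + s * e * c * n1.
  by move=> h; rewrite mulrDl -[l * b](addrK (l1 * q)) -h; ring.
case: j => [|j] /=; rewrite ?coef_map_id0 ?deriv0 // !coef_deriv => h;
  rewrite -[S * g * _ *+ _]mulr_natr -[S * f *+ _]mulr_natr; apply: key;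
  by rewrite !mulr_natr ?mulr0n.
Qed.

(** The logarithmic derivative b'/b is asymptotic to deg b / x at infinity, so
    L = S b'/b has degree deg S - 1 or L = 0. *)
Lemma lead_cofactor (K : numFieldType) (S L b : {poly K}) :
  b != 0 -> S * b^`() = L * b ->
  deg_le L ((size S).-1%:Z - 1) /\
  coefz L ((size S).-1%:Z - 1) = lead_coef S * (size b).-1%:R.
Proof.
move=> b0 Lb.
have : coefz b (size b).-1%:Z != 0 by rewrite coefz_size lead_coef_eq0.
have := @deg_le_size _ b; have := @deg_le_size _ S; rewrite -(coefz_size S).
move: (size S).-1 (size b).-1 => s beta Sd bd bl0.
have Sb' : deg_le (L * b) (s%:Z + (beta%:Z - 1)).
  by rewrite -Lb; apply: deg_leM Sd (deg_le_deriv bd) _.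
have Ld : deg_le L (s%:Z - 1).
  by apply: deg_leW (deg_le_factor bd bl0 Sb'); lia.
split=> //; apply: (mulIf bl0).
rewrite -(coefzM_top Ld bd erefl) -Lb.
rewrite (coefzM_top Sd (deg_le_deriv bd)); last by lia.
by rewrite coefz_deriv -mulrzr -pmulrn mulrA mulrAC.
Qed.

(** With the L given by [lead_cofactor], q |-> S q' - L q is S times the
    derivative of q/b, times b: it acts on leading terms like d/dx on functions
    of degree shifted by - deg b. *)
Lemma twisted_deriv_top (K : numFieldType) (S L q : {poly K}) (beta : nat)
    (a : int) :
  deg_le L ((size S).-1%:Z - 1) ->
  coefz L ((size S).-1%:Z - 1) = lead_coef S * beta%:R ->
  deg_le q a ->
  deg_le (S * q^`() - L * q) ((size S).-1%:Z - 1 + a) /\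
  coefz (S * q^`() - L * q) ((size S).-1%:Z - 1 + a) =
    lead_coef S * (a - beta%:Z)%:~R * coefz q a.
Proof.
have := @deg_le_size _ S; rewrite -(coefz_size S).
move: (size S).-1 => s Sd Ld Ll qa; split.
  apply: deg_leD; last by apply: deg_leN; apply: deg_leM Ld qa _.
  by apply: deg_leM Sd (deg_le_deriv qa) _; lia.
rewrite coefzD coefzN (coefzM_top Ld qa erefl) Ll.
rewrite (coefzM_top Sd (deg_le_deriv qa)); last by lia.
by rewrite coefz_deriv -mulrzr intrB -pmulrn; ring.
Qed.

(** The total weight w of P for the grading in which x has weight 1 and y has
    weight al. *)
Lemma weight_exists (K : fieldType) (P : {poly {poly K}}) (al : nat) : P != 0 ->
  exists w : int, (forall j : nat, deg_le P`_j (w - (j * al)%:Z)) /\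
    exists j : nat, coefz P`_j (w - (j * al)%:Z) != 0.
Proof.
move=> P0; pose F (j : 'I_(size P)) := ((size (P`_j)%R).-1 + j * al)%N.
have d_lt : ((size P).-1 < size P)%N by rewrite prednK ?size_poly_gt0.
have Pd : P`_(Ordinal d_lt) != 0 by rewrite /= -lead_coefE lead_coef_eq0.
case: (@arg_maxnP _ (Ordinal d_lt) (fun j => P`_j != 0) F Pd) => i Pi iM.
exists (F i)%:Z; split=> [j|]; last first.
  by exists i; rewrite /F PoszD addrK coefz_size lead_coef_eq0.
have [->|Pj0] := eqVneq P`_j 0; first exact: deg_le0.
have jd : (j < size P)%N.
  by rewrite ltnNge; apply: contra Pj0 => /(nth_default 0) ->.
apply: deg_leW (@deg_le_size _ P`_j).
by rewrite lerBrDr -PoszD lez_nat; apply: (iM (Ordinal jd)).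
Qed.

(** This is the equation for the coefficient of y^(d+1), where d is the y-degree
    of P. *)
Lemma invariant_lead (K : fieldType) (f g S L0 L1 : {poly K})
    (P : {poly {poly K}}) :
  P != 0 -> lienard_invariant f g S L0 L1 P ->
  S * (lead_coef P)^`() = L1 * lead_coef P.
Proof.
move=> P0 /invariant_coef/(_ (size P)).
rewrite coefXM size_poly_eq0 (negbTE P0) -lead_coefE !nth_default //.
by rewrite !mulr0 mul0rn addr0 => /eqP; rewrite subr_eq0 => /eqP.
Qed.

Lemma mulX_weight (K : fieldType) (P : {poly {poly K}}) (al : nat) (w : int) :
  (forall j : nat, deg_le P`_j (w - (j * al)%:Z)) ->
  forall j : nat, deg_le ('X * P)`_j (w - (j * al)%:Z + al%:Z).
Proof.
move=> Pw [|j]; rewrite coefXM /=; first exact: deg_le0.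
by apply: deg_leW (Pw j); lia.
Qed.

(** * Newton polygon at infinity *)

(** For the weight m + 1 of y, the terms y d/dx and f y d/dy of D are both
    homogeneous to leading order and raise the weight by m, while g d/dy raises
    it by n - m - 1 < m only.  The top part sum_j c_j x^(w - j (m+1)) y^j of P
    therefore obeys a two-term recursion

      (w - j (m+1) - beta) c_j = f0 (j + 1 - k) c_(j+1).

    It starts at j = k, where the factor on the right vanishes one step earlier,
    and it stops where the factor on the left vanishes.  As the term x^beta y^d
    is present in P, this is at j = d. *)
Lemma outer_weights (K : numFieldType) (f g S L0 L1 : {poly K})
    (P : {poly {poly K}}) :
  f != 0 -> S != 0 -> P != 0 -> ((size g).-1 < 2 * (size f).-1 + 1)%N ->
  lienard_invariant f g S L0 L1 P ->
  let M := (size f) in let d := (size P).-1 in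
  let w := ((size (lead_coef P)).-1 + d * M)%:Z in
  let sm := (size S).-1%:Z + (size f).-1%:Z in
  exists k : nat, [/\ (k <= d)%N,
    deg_le L0 sm /\ coefz L0 sm = - (lead_coef S * lead_coef f * k%:R),
    forall j, deg_le P`_j (w - (j * M)%:Z),
    coefz P`_k (w - (k * M)%:Z) != 0 &
    lead_coef f * coefz P`_k.+1 (w - (k.+1 * M)%:Z) =
      ((d - k) * M)%:R * coefz P`_k (w - (k * M)%:Z)].
Proof.
move=> f0 S0 P0 deg_gf inv; have /invariant_coef rec := inv.
have [] := lead_cofactor _ (invariant_lead P0 inv).
  by rewrite lead_coef_eq0.
have b0 : lead_coef (lead_coef P) != 0 by rewrite !lead_coef_eq0.
have fd := @deg_le_size _ f; have gd := @deg_le_size _ g.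
have Sd := @deg_le_size _ S.
have fl := coefz_size f; have Sl := coefz_size S.
have f00 : lead_coef f != 0 by rewrite lead_coef_eq0.
have S00 : lead_coef S != 0 by rewrite lead_coef_eq0.
have td q a := @twisted_deriv_top _ S L1 q (size (lead_coef P)).-1 a.
have bl := coefz_size (lead_coef P).
have -> : size f = (size f).-1.+1 by rewrite prednK ?size_poly_gt0.
move: (size f).-1 (size g).-1 (size S).-1 (size (lead_coef P)).-1
  fd gd Sd fl Sl td bl deg_gf => m n s beta fd gd Sd fl Sl td bl mn Ld Ll.
cbv zeta; set M := m.+1; set d := (size P).-1.
have [w [Pw [j0 Pj0]]] := weight_exists M P0.
have Xw := mulX_weight Pw.
have tw j := td _ _ Ld Ll (Xw j).
pose c j := coefz P`_j (w - (j * M)%:Z).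
have Sfd j : deg_le (S * f *+ j) (s%:Z + m%:Z).
  by apply: deg_leMn; apply: deg_leM Sd fd _; lia.
have Sfl j : coefz (S * f *+ j) (s%:Z + m%:Z) = lead_coef S * lead_coef f * j%:R.
  by rewrite coefzMn (coefzM_top Sd fd) // fl Sl mulr_natr.
have Sgd : deg_le (S * g) (s%:Z + n%:Z) by apply: deg_leM Sd gd _; lia.
(* This is where n <= 2 m enters: the g-term is of lower weight. *)
have gsmall j : deg_le (S * g * P`_j.+1 *+ j.+1)
    (s%:Z + m%:Z + (w - (j * M)%:Z) - 1).
  by apply: deg_leMn; apply: deg_leM Sgd (Pw j.+1) _; rewrite /M; lia.
have L0d : deg_le L0 (s%:Z + m%:Z).
  have /(deg_le_factor (Pw j0) Pj0) : deg_le (L0 * P`_j0)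
      (s%:Z + m%:Z + (w - (j0 * M)%:Z)).
    have -> : L0 * P`_j0 = (S * f *+ j0 + L0) * P`_j0 +
       S * g * P`_j0.+1 *+ j0.+1 - S * g * P`_j0.+1 *+ j0.+1 - S * f *+ j0 * P`_j0.
      by ring.
    rewrite -rec; apply: deg_leD; last first.
      by apply: deg_leN; apply: deg_leM (Sfd j0) (Pw j0) _; lia.
    apply: deg_leD; last by apply: deg_leN; apply: deg_leW (gsmall j0); lia.
    by apply: deg_leW (tw j0).1; rewrite /M; lia.
  by rewrite addrK.
have top j : lead_coef S * (w - (j * M)%:Z + M%:Z - beta%:Z)%:~R *
      coefz ('X * P)`_j (w - (j * M)%:Z + M%:Z) =
    (lead_coef S * lead_coef f * j%:R + coefz L0 (s%:Z + m%:Z)) * c j.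
  rewrite -(tw j).2 rec coefzD gsmall ?addr0; last by rewrite /M; lia.
  rewrite (coefzM_top (deg_leD (Sfd j) L0d) (Pw j)); last by rewrite /M; lia.
  by rewrite coefzD Sfl.
have c_lt j : c j != 0 -> (j <= d)%N.
  rewrite /d leqNgt; apply: contra => dj; rewrite /c nth_default ?coefz0 //.
  by move: dj; case: (size P).
(* k and e are the first and the last power of y in the top part. *)
have [k ck kmin] := ex_minnP (ex_intro (fun j => c j != 0) j0 Pj0).
have [e ce emax] := ex_maxnP (ex_intro (fun j => c j != 0) j0 Pj0) c_lt.
have L0l : coefz L0 (s%:Z + m%:Z) = - (lead_coef S * lead_coef f * k%:R).
  apply/eqP; rewrite eq_sym -subr_eq0 -opprD oppr_eq0 -(mulIr_eq0 _ (mulIf ck)).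
  rewrite -top coefXM; case: (k) kmin => [|k'] kmin; first by rewrite coefz0 mulr0.
  have /negbNE/eqP : ~~ (c k' != 0) by apply/negP => /kmin; rewrite ltnn.
  rewrite /c; have -> : w - (k'.+1 * M)%:Z + M%:Z = w - (k' * M)%:Z by lia.
  by move=> ->; rewrite mulr0.
have topS j : lead_coef S * (w - (j * M)%:Z - beta%:Z)%:~R * c j =
    lead_coef S * lead_coef f * (j.+1%:R - k%:R) * c j.+1.
  have := top j.+1; rewrite L0l -mulrBr coefXM => <-.
  by have -> : w - (j.+1 * M)%:Z + M%:Z = w - (j * M)%:Z by lia.
have we : w = (beta + e * M)%:Z.
  have := topS e; have /negbNE/eqP -> : ~~ (c e.+1 != 0).
    by apply/negP => /emax; rewrite ltnn.
  move/eqP; rewrite mulr0 !mulf_eq0 (negbTE ce) (negbTE S00) orbF /= intr_eq0.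
  by move/eqP; lia.
have ed : e = d.
  apply/eqP; rewrite eqn_leq c_lt //=; rewrite leqNgt; apply/negP => ed.
  have : coefz P`_d beta = 0.
    apply: (Pw d); rewrite we.
    have : (e.+1 * M <= d * M)%N by rewrite leq_mul.
    by rewrite mulSn {1}/M; lia.
  by rewrite /d -lead_coefE bl => /eqP; rewrite (negbTE b0).
subst e; rewrite -we; exists k; split=> //; first exact: c_lt.
have := topS k; rewrite -!mulrA => /(mulfI S00); rewrite -natrB // subSnn mul1r.
move=> <-; congr (_ * _); rewrite we.
have kd := c_lt k ck.
have -> : ((beta + d * M)%:Z - (k * M)%:Z - beta%:Z) = ((d - k) * M)%N%:Z.
  by rewrite mulnBl -subzn ?leq_mul //; lia.
by rewrite -pmulrn.
Qed.

(** For the weight r = n - m of y, the terms f y d/dy and g d/dy balance and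
    raise the weight by m, while y d/dx raises it by r - 1 < m only.  The top
    part of P satisfies f0 (j - k) c_j + g0 (j + 1) c_(j+1) = 0, so it is a
    multiple of (y + (g0/f0) x^r)^k: its last nonzero coefficient is c_k.  The
    hypothesis that p_k has degree exactly a then fixes the total weight. *)
Lemma inner_weights (K : numFieldType) (f g S L0 L1 : {poly K})
    (P : {poly {poly K}}) (k : nat) (a : int) :
  f != 0 -> g != 0 -> S != 0 -> P != 0 ->
  ((size f).-1 < (size g).-1)%N -> ((size g).-1 < 2 * (size f).-1 + 1)%N ->
  lienard_invariant f g S L0 L1 P ->
  let sm := (size S).-1%:Z + (size f).-1%:Z in
  let r := ((size g).-1 - (size f).-1)%N in
  deg_le L0 sm -> coefz L0 sm = - (lead_coef S * lead_coef f * k%:R) ->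
  deg_le P`_k a -> coefz P`_k a != 0 ->
  (forall j, deg_le P`_j (a + (k * r)%:Z - (j * r)%:Z)) /\
  lead_coef f * coefz ('X * P)`_k (a + r%:Z) =
    k%:R * lead_coef g * coefz P`_k a.
Proof.
move=> f0 g0 S0 P0 deg_fg deg_gf inv; have /invariant_coef rec := inv.
have [] := lead_cofactor _ (invariant_lead P0 inv).
  by rewrite lead_coef_eq0.
have fd := @deg_le_size _ f; have gd := @deg_le_size _ g.
have Sd := @deg_le_size _ S.
have fl := coefz_size f; have Sl := coefz_size S; have gl := coefz_size g.
have f00 : lead_coef f != 0 by rewrite lead_coef_eq0.
have S00 : lead_coef S != 0 by rewrite lead_coef_eq0.
have td q b := @twisted_deriv_top _ S L1 q (size (lead_coef P)).-1 b.
move: (size f).-1 (size g).-1 (size S).-1 (size (lead_coef P)).-1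
  fd gd Sd fl Sl gl td deg_fg deg_gf
  => m n s beta fd gd Sd fl Sl gl td mn nm Ld Ll.
cbv zeta => L0d L0l Pka Pka0.
have [r nE] : {r | n = (m + r)%N} by exists (n - m)%N; rewrite subnKC // ltnW.
subst n; rewrite addKn.
have [w [Pw [j0 Pj0]]] := weight_exists r P0.
have Xw := mulX_weight Pw.
have tw j := (td _ _ Ld Ll (Xw j)).1.
pose c j := coefz P`_j (w - (j * r)%:Z).
have Sfd j : deg_le (S * f *+ j + L0) (s%:Z + m%:Z).
  by apply: deg_leD => //; apply: deg_leMn; apply: deg_leM Sd fd _; lia.
have Sfl j : coefz (S * f *+ j + L0) (s%:Z + m%:Z) =
    lead_coef S * lead_coef f * (j%:R - k%:R).
  by rewrite coefzD L0l coefzMn (coefzM_top Sd fd) // fl Sl mulrBr !mulr_natr.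
have Sgd : deg_le (S * g) (s%:Z + (m + r)%N%:Z) by apply: deg_leM Sd gd _; lia.
have small j : lead_coef f * (j%:R - k%:R) * c j +
    lead_coef g * j.+1%:R * c j.+1 = 0.
  apply: (mulfI S00); rewrite mulr0.
  have := tw j (s%:Z + m%:Z + (w - (j * r)%:Z)); rewrite rec => tw0.
  rewrite -[RHS]tw0; last by lia.
  rewrite coefzD coefzMn (coefzM_top (Sfd j) (Pw j)) // Sfl.
  rewrite (coefzM_top Sgd (Pw j.+1)); last by lia.
  by rewrite (coefzM_top Sd gd) // Sl gl -/(c j) -/(c j.+1) -mulr_natr; ring.
have c_le j : c j != 0 -> (j <= size P)%N.
  rewrite leqNgt; apply: contra => dj; rewrite /c nth_default ?coefz0 //.
  exact: ltnW.
(* The top part ends at the power e of y, where the recursion forces e = k. *)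
have [e ce emax] := ex_maxnP (ex_intro (fun j => c j != 0) j0 Pj0) c_le.
have ek : e = k.
  have := small e; have /negbNE/eqP -> : ~~ (c e.+1 != 0).
    by apply/negP => /emax; rewrite ltnn.
  move/eqP; rewrite mulr0 addr0 !mulf_eq0 (negbTE ce) (negbTE f00) orbF /=.
  by rewrite subr_eq0 eqr_nat => /eqP.
subst e; have wa : w - (k * r)%:Z = a := deg_le_unique (Pw k) ce Pka Pka0.
have wE : w = a + (k * r)%:Z by rewrite -wa subrK.
rewrite -wE; split=> //; case: k L0l Sfl small ce emax wa wE Pka Pka0
  => [|k] L0l Sfl small ce emax wa wE Pka Pka0.
  by rewrite coefXM coefz0 mulr0 !mul0r.
have /eqP := small k; rewrite addrC addr_eq0 coefXM => /eqP /= e.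
have -> : a + r%:Z = w - (k * r)%:Z by lia.
rewrite -wa -/(c k) -/(c k.+1) [k.+1%:R * _]mulrC e.
by rewrite -natr1; ring.
Qed.

(** Let p_k have leading term c x^a.  By the two gradings p_(k-1) and p_(k+1)
    have leading terms k (g0/f0) c x^(a + r) and
    ((d-k)(m+1)/f0) c x^(a - m - 1).  In the equation for j = k both contribute in degree deg S - 1 + a + r, and
    so (k S f + L0) p_k has at most this degree; comparing coefficients gives
    the second formula. *)
Lemma cofactor_leading_data (K : numFieldType) (f g S L0 L1 : {poly K})
    (P : {poly {poly K}}) :
  f != 0 -> g != 0 -> S != 0 -> P != 0 ->
  ((size f).-1 < (size g).-1)%N -> ((size g).-1 < 2 * (size f).-1 + 1)%N ->
  lienard_invariant f g S L0 L1 P ->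
  let d := (size P).-1 in
  let sm := (size S).-1%:Z + (size f).-1%:Z in
  let r := ((size g).-1 - (size f).-1)%N in
  exists k : nat, [/\ (k <= d)%N,
    coefz L0 sm = - (lead_coef S * lead_coef f * k%:R) &
    lead_coef f * coefz (S * f *+ k + L0) ((size S).-1%:Z + r%:Z - 1) =
    lead_coef S * lead_coef g * ((r * k)%:R - ((d - k) * size f)%:R)].
Proof.
move=> f0 g0 S0 P0 deg_fg deg_gf inv; have /invariant_coef rec := inv.
have := outer_weights f0 S0 P0 deg_gf inv.
cbv zeta => -[k [kd [L0d L0l] Pw Pk0 top]].
have := inner_weights f0 g0 S0 P0 deg_fg deg_gf inv L0d L0l (Pw k) Pk0.
cbv zeta => -[Pv small].
exists k; split=> //.
have [] := lead_cofactor _ (invariant_lead P0 inv).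
  by rewrite lead_coef_eq0.
have gd := @deg_le_size _ g; have Sd := @deg_le_size _ S.
have Sl := coefz_size S; have gl := coefz_size g.
have td q b := @twisted_deriv_top _ S L1 q (size (lead_coef P)).-1 b.
have f00 : lead_coef f != 0 by rewrite lead_coef_eq0.
have sf : size f = (size f).-1.+1 by rewrite prednK ?size_poly_gt0.
rewrite sf in Pw Pk0 top small Pv *.
move: (size f).-1 (size g).-1 (size S).-1 (size (lead_coef P)).-1
  gd Sd Sl gl td deg_fg deg_gf L0d L0l Pw Pk0 top small Pv
  => m n s beta gd Sd Sl gl td mn nm L0d L0l Pw Pk0 top small Pv Ld Ll.
have [r nE] : {r | n = (m + r)%N} by exists (n - m)%N; rewrite subnKC // ltnW.
subst n; rewrite addKn in small Pv *.
set d := (size P).-1 in kd Pw Pk0 top small Pv *.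
set M := m.+1 in Pw Pk0 top small Pv *.
have wa : (beta + d * M)%:Z - (k * M)%:Z = beta%:Z + ((d - k) * M)%N%:Z.
  by rewrite mulnBl -subzn ?leq_mul //; lia.
have wb : (beta + d * M)%:Z - (k.+1 * M)%:Z = beta%:Z + ((d - k) * M)%N%:Z - M%:Z.
  by rewrite -wa; lia.
have Pk1 := Pw k.+1; have Pk := Pw k.
rewrite wb in Pk1 top; rewrite wa in Pk Pk0 top small Pv.
set t := ((d - k) * M)%N in wa wb Pk1 Pk Pk0 top small Pv *.
have Xd := @mulX_weight _ _ _ _ Pv k; rewrite addrK in Xd.
have [twd twl] := td _ _ Ld Ll Xd.
have Sgd : deg_le (S * g) (s%:Z + (m + r)%N%:Z) by apply: deg_leM Sd gd _; lia.
have gP : deg_le (S * g * P`_k.+1 *+ k.+1) (s%:Z - 1 + (beta%:Z + t%:Z + r%:Z)).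
  by apply: deg_leMn; apply: deg_leM Sgd Pk1 _; rewrite /M; lia.
have Ud : deg_le (S * f *+ k + L0) (s%:Z + r%:Z - 1).
  apply: deg_leW (deg_le_factor Pk Pk0 (c := s%:Z - 1 + (beta%:Z + t%:Z + r%:Z)) _).
    by lia.
  have -> : (S * f *+ k + L0) * P`_k = (S * f *+ k + L0) * P`_k +
     S * g * P`_k.+1 *+ k.+1 - S * g * P`_k.+1 *+ k.+1 by rewrite addrK.
  by rewrite -rec; apply: deg_leD twd (deg_leN gP).
apply: (mulIf Pk0); move: twl; rewrite rec coefzD coefzMn.
rewrite (coefzM_top Ud Pk); last by lia.
rewrite (coefzM_top Sgd Pk1); last by rewrite /M; lia.
rewrite (coefzM_top Sd gd) // Sl gl.
have -> : beta%:Z + t%:Z + r%:Z - beta%:Z = (t + r)%N%:Z by lia.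
rewrite -pmulrn -mulr_natr.
move: small top.
move: (coefz _ _) (coefz _ _) (coefz _ _) (coefz _ _) => X Y Z U small top e.
have -> : lead_coef f * X * Z = lead_coef f *
    (X * Z + lead_coef S * lead_coef g * Y * k.+1%:R) -
    lead_coef S * lead_coef g * k.+1%:R * (lead_coef f * Y) by ring.
rewrite mulr_natr e top mulrCA small natrD natrM -natr1.
by ring.
Qed.

(** The characteristic is zero, so the two formulas of [cofactor_leading_data]
    give first k, then (d - k)(m + 1) and hence d; beta is read off L1. *)
Lemma cofactor_determines_lead (K : numFieldType) (f g S L0 L1 : {poly K})
    (P Q : {poly {poly K}}) :
  f != 0 -> g != 0 -> S != 0 -> P != 0 -> Q != 0 ->
  ((size f).-1 < (size g).-1)%N -> ((size g).-1 < 2 * (size f).-1 + 1)%N ->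
  lienard_invariant f g S L0 L1 P -> lienard_invariant f g S L0 L1 Q ->
  (size P).-1 = (size Q).-1 /\
  (size (lead_coef P)).-1 = (size (lead_coef Q)).-1.
Proof.
move=> f0 g0 S0 P0 Q0 deg_fg deg_gf invP invQ.
have S00 : lead_coef S != 0 by rewrite lead_coef_eq0.
have f00 : lead_coef f != 0 by rewrite lead_coef_eq0.
have g00 : lead_coef g != 0 by rewrite lead_coef_eq0.
split.
  have /= [k [kd kE UE]] := cofactor_leading_data f0 g0 S0 P0 deg_fg deg_gf invP.
  have /= [l [ld lE VE]] := cofactor_leading_data f0 g0 S0 Q0 deg_fg deg_gf invQ.
  have /eqP : k%:R = l%:R :> K.
    by apply: (mulfI (mulf_neq0 S00 f00)); apply: oppr_inj; rewrite -kE -lE.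
  rewrite eqr_nat => /eqP kl; subst l; move: UE; rewrite VE.
  move/(mulfI (mulf_neq0 S00 g00))/addrI/oppr_inj/eqP; rewrite eqr_nat.
  rewrite eqn_pmul2r ?size_poly_gt0 // => /eqP.
  by lia.
have [|_ Pl] := lead_cofactor _ (invariant_lead P0 invP).
  by rewrite lead_coef_eq0.
have [|_ Ql] := lead_cofactor _ (invariant_lead Q0 invQ).
  by rewrite lead_coef_eq0.
by apply/eqP; rewrite -(eqr_nat K); apply/eqP/(mulfI S00); rewrite -Pl -Ql.
Qed.

(** * Rational functions *)

Local Notation "x %:F" := (@FracField.tofrac _ x).

(** Both terms are divided by their pseudo-gcd over A; the constants that
    pseudo-division introduces are moved across. *)
Lemma fraction_coprime (A : idomainType) (r : {fraction {poly A}}) :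
  exists P Q : {poly A}, [/\ Q != 0, coprimep P Q & r = P%:F / Q%:F].
Proof.
have [P [Q [Q0 ->]]] : exists P Q : {poly A}, Q != 0 /\ r = P%:F / Q%:F.
  exists \n_(repr r), \d_(repr r); have d0 := denom_ratioP (repr r); split=> //.
  apply: (@mulIf _ (\d_(repr r))%:F); first by rewrite tofrac_eq0.
  rewrite divfK ?tofrac_eq0 // -[X in X * _]reprK; unlock FracField.tofrac.
  rewrite -[LHS]FracField.pi_mul; apply/eqmodP.
  rewrite /= FracField.equivfE /FracField.mulf.
  by rewrite !numden_Ratio ?mulf_neq0 ?oner_eq0 // !mulr1 mulrC.
set G := gcdp P Q.
have G0 : G != 0 by rewrite gcdp_eq0 negb_and Q0 orbT.
have lG k : lead_coef G ^+ k != 0 by rewrite expf_neq0 // lead_coef_eq0.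
have [a a0 PG] : exists2 a, a != 0 & P %/ G * G = a *: P.
  by eexists; [apply: lG|apply: Pdiv.WeakIdomain.divpK (dvdp_gcdl P Q)].
have [b b0 QG] : exists2 b, b != 0 & Q %/ G * G = b *: Q.
  by eexists; [apply: lG|apply: Pdiv.WeakIdomain.divpK (dvdp_gcdr P Q)].
exists (b *: (P %/ G)), (a *: (Q %/ G)).
have Q1 : Q %/ G != 0.
  by apply: contraNneq b0 => Q1; move: QG; rewrite Q1 mul0r => /esym/eqP;
    rewrite scale_poly_eq0 (negbTE Q0) orbF.
split; first by rewrite scale_poly_eq0 negb_or a0.
  by rewrite coprimepZl // coprimepZr // coprimep_div_gcd // Q0 orbT.
apply/eqP; rewrite eqr_div ?tofrac_eq0 ?scale_poly_eq0 ?negb_or ?a0 //.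
rewrite -!tofracM tofrac_eq; apply/eqP/(mulIf G0).
rewrite -!mul_polyC in PG QG *.
transitivity (a%:P * P * (Q %/ G * G)); first by ring.
rewrite QG; transitivity (b%:P * Q * (P %/ G * G)); last by ring.
by rewrite PG; ring.
Qed.

Lemma lienard_der_subC (K : fieldType) (f g : {poly K}) (c : K)
    (P Q : {poly {poly K}}) :
  lienard_der f g (P - c%:P%:P * Q) =
  lienard_der f g P - c%:P%:P * lienard_der f g Q.
Proof.
have dx : map_poly (@deriv K) (P - c%:P%:P * Q) =
    map_poly (@deriv K) P - c%:P%:P * map_poly (@deriv K) Q.
  apply/polyP => i; rewrite coefB coefCM !coef_map_id0 ?deriv0 //.
  by rewrite coefB coefCM derivB derivM derivC mul0r add0r.
rewrite /lienard_der dx derivB derivM derivC mul0r add0r.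
move: (map_poly _ P) (map_poly _ Q) P^`() Q^`() => X Y Z T.
by move: (f%:P * 'X + _) c%:P%:P => U V; ring.
Qed.

Lemma size_lienard_der (K : fieldType) (f g : {poly K}) (P : {poly {poly K}}) :
  (size (lienard_der f g P) <= (size P).+1)%N.
Proof.
apply/leq_sizeP => j Pj; rewrite /lienard_der coefB mulrDl coefD -mulrA !coefCM.
rewrite !coefXM; case: j Pj => // j Pj /=.
rewrite coef_map_id0 ?deriv0 // !coef_deriv !(@nth_default _ 0 P) ?deriv0 //;
  try by rewrite ltnW // ltnW.
by case: j {Pj} => [|j]; rewrite ?mul0rn !mulr0 ?addr0 subr0.
Qed.

Lemma size2_polyCX (A : nzRingType) (L : {poly A}) :
  (size L <= 2)%N -> L = (L`_0)%:P + (L`_1)%:P * 'X.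
Proof.
move=> L2; apply/polyP => -[|[|i]]; rewrite coefD coefC coefMX coefC /=.
- by rewrite addr0.
- by rewrite add0r.
- by rewrite addr0 nth_default // (leq_trans L2).
Qed.

Lemma first_integral_cross (K : numFieldType) (f g : {poly K})
    (P Q : {poly {poly K}}) :
  Q != 0 ->
  rf_y K * partial_x (P%:F / Q%:F) -
    (rf_of_x f * rf_y K + rf_of_x g) * partial_y (P%:F / Q%:F) = 0 ->
  lienard_der f g P * Q = P * lienard_der f g Q.
Proof.
move=> Q0; rewrite partial_x_div // partial_y_div // !mulrA -mulrBl.
move/eqP; rewrite mulf_eq0 invr_eq0 tofrac_eq0 (negbTE (expf_neq0 _ Q0)) orbF.
rewrite /rf_y /rf_of_x -!tofracM -tofracD -!tofracM -tofracB tofrac_eq0 subr_eq0.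
rewrite /lienard_der => /eqP; move: (map_poly _ P) (map_poly _ Q) P^`() Q^`().
move: 'X (_ + g%:P) => x h X Y Z T e; apply/eqP; rewrite -subr_eq0; apply/eqP.
transitivity (x * (X * Q - P * Y) - h * (Z * Q - P * T)); first by ring.
by rewrite e subrr.
Qed.

(** Multiplying the Bezout identity u P + v Q = S by DP and using
    DP * Q = P * DQ gives S DP = (u DP + v DQ) P, and symmetrically for Q. *)
Lemma coprime_cofactor (K : fieldType) (f g : {poly K})
    (P Q : {poly {poly K}}) :
  P != 0 -> Q != 0 -> coprimep P Q ->
  lienard_der f g P * Q = P * lienard_der f g Q ->
  exists S L0 L1 : {poly K}, [/\ S != 0,
    lienard_invariant f g S L0 L1 P & lienard_invariant f g S L0 L1 Q].
Proof.
move=> P0 Q0 /Bezout_coprimepP [[u v] /= uv] PQ.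
have /size_poly1P [S S0 uvS] : size (u * P + v * Q) == 1%N.
  by rewrite size_poly_eq1.
pose L := u * lienard_der f g P + v * lienard_der f g Q.
have LP : S%:P * lienard_der f g P = L * P.
  rewrite -uvS /L !mulrDl -[v * Q * _]mulrA [Q * _]mulrC PQ.
  by congr (_ + _); rewrite -!mulrA [P * _]mulrC.
have LQ : S%:P * lienard_der f g Q = L * Q.
  rewrite -uvS /L !mulrDl -[u * P * _]mulrA -PQ.
  by congr (_ + _); rewrite -!mulrA // [Q * _]mulrC.
have L2 : (size L <= 2)%N.
  have [->|L0] := eqVneq L 0; first by rewrite size_poly0.
  have : (size (L * P)%R <= (size P).+1)%N.
    rewrite -LP mul_polyC; apply: leq_trans (size_scale_leq _ _) _.
    exact: size_lienard_der.
  rewrite size_mul // [size P]polySpred // addnS /= => h.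
  by rewrite -(leq_add2r (size P).-1).
by exists S, L`_0, L`_1; rewrite /lienard_invariant -(size2_polyCX L2).
Qed.

Lemma no_rational_first_integral (K : numFieldType) (f g : {poly K}) :
  f != 0 -> g != 0 ->
  ((size f).-1 < (size g).-1)%N -> ((size g).-1 < 2 * (size f).-1 + 1)%N ->
  ~ exists r : ratfun K, lienard_rational_first_integral f g r.
Proof.
move=> f0 g0 deg_fg deg_gf [r [r_nonconst rD]].
have [P [Q [Q0 PQ rE]]] := fraction_coprime r.
have P0 : P != 0.
  apply/eqP => P0; apply: r_nonconst; exists 0.
  by rewrite rE P0 /rf_const tofrac0 mul0r.
rewrite rE in rD; have DPQ := first_integral_cross Q0 rD.
have [S [L0 [L1 [S0 invP invQ]]]] := coprime_cofactor P0 Q0 PQ DPQ.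
(* c is chosen to cancel the term x^b y^d, the leading term of the leading
   coefficient, which P - c Q would have to contain if it were nonzero. *)
pose d := (size Q).-1; pose b := (size (lead_coef Q)).-1.
pose c := P`_d`_b / Q`_d`_b; pose T := P - c%:P%:P * Q.
have Qdb : Q`_d`_b != 0 by rewrite !lead_coef_eq0.
have T0 : T != 0.
  apply/eqP => /eqP; rewrite subr_eq0 => /eqP PcQ; apply: r_nonconst; exists c.
  by rewrite rE PcQ tofracM mulfK ?tofrac_eq0.
have invT : lienard_invariant f g S L0 L1 T.
  rewrite /lienard_invariant lienard_der_subC mulrBr [in LHS]mulrCA invQ invP.
  by rewrite [in RHS]mulrBr [in RHS]mulrCA.
have [Td Tb] := cofactor_determines_lead f0 g0 S0 T0 Q0 deg_fg deg_gf invT invQ.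
have : lead_coef (lead_coef T) != 0 by rewrite !lead_coef_eq0.
rewrite [lead_coef (lead_coef T)]lead_coefE Tb [lead_coef T]lead_coefE Td.
by rewrite -/d -/b coefB coefCM coefB coefCM divfK // subrr eqxx.
Qed.

Theorem mainTheorem6 (R : realType) (f g : {poly R[i]})
    (f_neq0 : f != 0) (g_neq0 : g != 0)
    (deg_fg : ((size f).-1 < (size g).-1)%N)
    (deg_gf : ((size g).-1 < 2 * (size f).-1 + 1)%N) :
  ~ exists r : ratfun R[i], lienard_rational_first_integral f g r.
Proof. exact: no_rational_first_integral. Qed.
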